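(* The functionals $T_k^{(\alpha_1,\dots,\alpha_k)}$ generated by the recursive relation $$T_0=u_1^2,\qquad r_0=-\frac{1}{u_1};$$ $$T_1^{(\alpha_1)}=T_0\, r_1^{\alpha_1},\qquad r_1=\frac{1}{u_1^2}D_x r_0;$$ $$T_2^{(\alpha_1,\alpha_2)}=T_1^{(\alpha_1)}\, r_2^{\alpha_2},\qquad r_2=\frac{1}{u_1^2}D_x r_1;$$ $$\cdots$$ $$T_k^{(\alpha_1,\dots,\alpha_k)}=T_{k-1}^{(\alpha_1,\dots,\alpha_{k-1})}\, r_k^{\alpha_k},\qquad r_k=\frac{1}{u_1^2}D_x r_{k-1};$$ $$\cdots$$ (where the $\alpha_i$ are constant parameters) are $(k+1)$th order conserved densities of the Hunter-Saxton equation $u_{xt}=2uu_{xx}+u_x^2$. Moreover, $T_1^{(1)}\equiv 0$, $T_2^{(\alpha_1,1)}\equiv 0$, and when $\alpha_k\ne -1$ and $k\ge 2$, $$T_{k+1}^{(\alpha_1,\dots,\alpha_k,1)}\equiv-\sum_{i=1}^{k-1}\frac{\alpha_i}{\alpha_k+1}\,T_k^{(\alpha_1,\dots,\alpha_{i-1},\,\alpha_i-1,\,\alpha_{i+1}+1,\,\dots,\,\alpha_{k-1},\,\alpha_k+1+\delta_{i,k-1})},$$ where in the $i$-th summand the exponent $\alpha_i$ is lowered by $1$, $\alpha_{i+1}$ is raised by $1$, and $\alpha_k$ is (additionally) raised by $1$; so for $i=k-1$ the last two exponents are $\alpha_{k-1}-1$ and $\alpha_k+2$.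
   Context: $u=u(x,t)$ is a scalar dependent variable and $u_k=\partial_x^k u$. Differential functions are smooth functions of $u$ and finitely many of its $x$-derivatives, with total derivative $D_x=\sum_{k\ge0}u_{k+1}\,\partial/\partial u_k$; the order of a differential function is the highest order of $x$-derivative of $u$ in it. One writes $g\equiv h$ if $g-h\in\operatorname{Im}D_x$; a functional is an equivalence class of differential functions under $\equiv$, and is denoted by any of its representatives. $D_t$ is the total $t$-derivative along solutions of the Hunter-Saxton equation; for a differential function $G$ depending only on $u_1,u_2,\dots$ it is $D_tG=\sum_{k\ge1}D_x^{k-1}(2uu_2+u_1^2)\,\partial G/\partial u_k$. $G$ is a conserved density if $D_tG\in\operatorname{Im}D_x$. $\delta_{i,j}$ is the Kronecker delta.
   Formalization: The order of T_k is claimed to be exactly k+1 only when k=0 or α_k≠0, and at most k+1 otherwise, since for α_k=0 one has T_k=T_{k-1} (e.g. T_1^{(0)}=u_1^2 has order 1). *)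

(* Defs.v *)
From HB Require Import structures.
From mathcomp Require Import all_boot all_order all_algebra.
From mathcomp Require Import all_classical all_reals all_analysis.

Set Implicit Arguments.
Unset Strict Implicit.
Unset Printing Implicit Defensive.

Import Order.TTheory GRing.Theory Num.Theory.
Import numFieldNormedType.Exports.

Local Open Scope classical_set_scope.
Local Open Scope ring_scope.

(* [z k] is the value of u_k.  The topology is the product one, so for a
   function of finitely many coordinates continuity has its usual meaning on a
   finite-dimensional jet space. *)
Definition jet (R : realType) := prod_topology (fun _ : nat => R).

Definition jet_set (R : realType) (z : jet R) (k : nat) (s : R) : jet R :=
  fun j => if j == k then s else z j.

Definition pd (R : realType) (k : nat) (F : jet R -> R) : jet R -> R :=
  fun z => derive1 (fun s : R => F (jet_set z k s)) (z k).

(* C^oo on U: every iterated partial derivative exists and is continuous. *)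
Definition smooth_on (R : realType) (U : set (jet R)) (F : jet R -> R) : Prop :=
  forall (s : seq nat) (z : jet R), U z ->
    {for z, continuous (foldr (@pd R) F s)} /\
    forall k, derivable (fun t : R => foldr (@pd R) F s (jet_set z k t)) (z k) 1.

Definition depends_on (R : realType) (U : set (jet R)) (A : set nat)
    (F : jet R -> R) : Prop :=
  forall z w : jet R, U z -> U w -> (forall i, A i -> z i = w i) -> F z = F w.

Definition order_le (R : realType) (U : set (jet R)) (n : nat)
    (F : jet R -> R) : Prop :=
  depends_on U [set i | (i <= n)%N] F.

Definition has_order (R : realType) (U : set (jet R)) (n : nat)
    (F : jet R -> R) : Prop :=
  order_le U n F /\ exists2 z, U z & pd n F z <> 0.

(* Differential functions are given by total functions on jets, of which only
   the values on the open domain U are meaningful. *)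
Definition diff_fun (R : realType) (U : set (jet R)) (F : jet R -> R) : Prop :=
  [/\ open U, exists n, order_le U n F & smooth_on U F].

(* The sum over all k is the library's finitely supported sum; on the domain of
   a differential function F only the k up to the order of F contribute. *)
Definition Dx (R : realType) (F : jet R -> R) : jet R -> R :=
  fun z => \sum_(k \in [set: nat]) z k.+1 * pd k F z.

Definition in_im_Dx (R : realType) (U : set (jet R)) (G : jet R -> R) : Prop :=
  exists2 F, diff_fun U F & forall z, U z -> G z = Dx F z.

(* Equality of the functionals represented by g and h. *)
Definition func_eq (R : realType) (U : set (jet R)) (g h : jet R -> R) : Prop :=
  in_im_Dx U (fun z => g z - h z).

(* u_{xt} = 2 u u_{xx} + u_x^2 *)
Definition HS_rhs (R : realType) : jet R -> R :=
  fun z => 2 * z 0%N * z 2%N + z 1%N ^+ 2.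

(* For G not depending on u_0. *)
Definition Dt (R : realType) (G : jet R -> R) : jet R -> R :=
  fun z => \sum_(k \in [set k | (1 <= k)%N])
             iter k.-1 (@Dx R) (@HS_rhs R) z * pd k G z.

Definition conserved_density (R : realType) (U : set (jet R))
    (G : jet R -> R) : Prop :=
  [/\ diff_fun U G, depends_on U [set k | (1 <= k)%N] G & in_im_Dx U (Dt G)].

(* x^a for a real exponent a: the usual integer power, of a base of any sign,
   when a is an integer, and exp (a ln x) otherwise. *)
Definition rpow (R : realType) (x a : R) : R :=
  if a \is a Num.int then x ^ Num.floor a else x `^ a.

(* Where x^a is defined and smooth in x. *)
Definition rpow_dom (R : realType) (x a : R) : bool :=
  [|| a \is a Num.nat, (a \is a Num.int) && (x != 0) | 0 < x].

Fixpoint r (R : realType) (k : nat) : jet R -> R :=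
  match k with
  | 0 => fun z => - (z 1%N)^-1
  | k'.+1 => fun z => (z 1%N ^+ 2)^-1 * Dx (@r R k') z
  end.

(* T_k^(alpha 1, ..., alpha k); the other values of alpha are not used. *)
Fixpoint T (R : realType) (k : nat) (alpha : nat -> R) : jet R -> R :=
  match k with
  | 0 => fun z => z 1%N ^+ 2
  | k'.+1 => fun z => T k' alpha z * rpow (@r R k'.+1 z) (alpha k'.+1)
  end.

(* The natural domain of T_k^(alpha 1, ..., alpha k): all jets if k = 0. *)
Definition T_dom (R : realType) (k : nat) (alpha : nat -> R) : set (jet R) :=
  [set z | forall i, (1 <= i <= k)%N ->
             z 1%N != 0 /\ rpow_dom (@r R i z) (alpha i)].

Definition set_exp (R : realType) (alpha : nat -> R) (k : nat) (a : R) :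
    nat -> R :=
  fun j => if j == k then a else alpha j.

(* The exponents of the i-th summand, 1 <= i <= k - 1.  The last two increments
   both apply at j = k if i = k - 1.  If alpha i = 0, the exponent of r_i
   becomes -1, but then the summand has coefficient 0 and is absent. *)
Definition shift_exp (R : realType) (alpha : nat -> R) (k i : nat) : nat -> R :=
  fun j => alpha j - (j == i)%:R + (j == i.+1)%:R + (j == k)%:R.

(* Main.v *)
Require Import Defs.
From mathcomp Require Import all_boot all_order all_algebra.
From mathcomp Require Import all_classical all_reals all_analysis.
From mathcomp Require Import ring lra.

(* On functions of u_1, u_2, ... the operator L = D_t - 2 u D_x commutes with
   u_1^-2 D_x, because D_t and D_x commute and L u_1 = u_1^2.  Since L r_0 = 1,
   it follows that L r_k = 0 for k >= 1, and then D_t T_k = D_x (2 u T_k).  The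
   equivalences come from D_x r_k = u_1^2 r_(k+1): integrating the factor
   r_k^(alpha k) D_x r_k of T_(k+1) by parts gives the sum.

   All functions involved are values of formal expressions closed under formal
   partial derivatives, which gives smoothness, and gives [D_t, D_x] = 0 by
   induction on expressions, without the symmetry of second derivatives. *)

Set Implicit Arguments.
Unset Strict Implicit.
Unset Printing Implicit Defensive.

Import Order.TTheory GRing.Theory Num.Theory.
Import numFieldNormedType.Exports.

Local Open Scope classical_set_scope.
Local Open Scope ring_scope.

(** * Real powers: domains and derivatives *)

Section RealPower.
Context {R : realType}.
Implicit Types x a : R.

Lemma rpow_nat x (n : nat) : rpow x n%:R = x ^+ n.
Proof. by rewrite /rpow natr_int -[n%:R]/(n%:Z%:~R) intrKfloor. Qed.

Lemma rpow_opp_nat x (n : nat) : rpow x (- n%:R) = x ^- n.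
Proof.
rewrite /rpow rpredN natr_int -[n%:R]/(n%:Z%:~R) -intrN intrKfloor.
by rewrite -exprnN.
Qed.

(** Exponent 0 is set apart because x^0 is defined at x = 0 and x^-1 is not; derivatives of powers
    treat it separately for the same reason. *)
Lemma rpow_domB1 x a : rpow_dom x a -> a != 0 -> rpow_dom x (a - 1).
Proof.
rewrite /rpow_dom => /or3P[/natrP[[|n] ->]|/andP[ai x0]|->].
- by rewrite mulr0n eqxx.
- by rewrite -natr1 addrK natr_nat.
- by rewrite (rpredB ai) ?rpred1// x0 !orbT.
- by rewrite !orbT.
Qed.

Lemma rpow_domS x a : rpow_dom x a -> rpow_dom x (a + 1).
Proof.
rewrite /rpow_dom => /or3P[an|/andP[ai x0]|->].
- by rewrite (rpredD an) ?rpred1.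
- by rewrite (rpredD ai) ?rpred1// x0 !orbT.
- by rewrite !orbT.
Qed.

(** This can fail off the domain: for x = 0 and a = -1 the two sides are 1 and 0. *)
Lemma rpowS x a : rpow_dom x a -> rpow x (a + 1) = rpow x a * x.
Proof.
move=> /or3P[/natrP[n ->]|/andP[/intrP[m ->] x0]|x0].
- by rewrite natr1 !rpow_nat exprSr.
- by rewrite /rpow -intrD1 !intr_int !intrKfloor expfzDr.
- rewrite /rpow rpredDr ?rpred1//; case: ifPn => [/intrP[m ->]|_].
    by rewrite -intrD1 !intrKfloor expfzDr ?gt_eqF.
  by rewrite powRD ?(gt_eqF x0) ?implybT// (powRr1 (ltW x0)).
Qed.

Lemma rpow1 a : rpow 1 a = 1.
Proof. by rewrite /rpow exp1rz powR1; case: ifP. Qed.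

Lemma is_derive_expn x n :
  is_derive x 1 (fun y => y ^+ n) (n%:R * x ^+ n.-1).
Proof.
have := @is_deriveX R R id n x 1 1 (is_derive_id _ _).
have -> : id ^+ n = (fun y : R => y ^+ n) by apply/funext => y; rewrite exprfctE.
by move=> h; apply: is_derive_eq h _; rewrite /GRing.scale/= mulr1.
Qed.

Lemma is_derive_expz x (m : int) : x != 0 ->
  is_derive x 1 (fun y => y ^ m) (m%:~R * x ^ (m - 1)).
Proof.
move=> x0; case: (intP m) => [|n|n].
- by rewrite mul0r; exact: is_derive_cst.
- have -> : n.+1%:Z - 1 = n :> int by rewrite -addn1 PoszD addrK.
  exact: is_derive_expn.
- have -> : (fun y : R => y ^ (- n.+1%:Z)) = fun y => (y ^+ n.+1)^-1.
    by apply/funext => y; rewrite -exprnN.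
  have x1 : x ^+ n.+1 != 0 by rewrite expf_neq0.
  have := @is_deriveV _ (fun y => y ^+ n.+1) x _ 1 x1 (is_derive_expn x n.+1).
  move=> h; apply: is_derive_eq h _.
  rewrite /GRing.scale/= -opprD -PoszD addn1 -exprnN intrN.
  rewrite -[n.+1%:Z%:~R]/(n.+1%:R) !exprS; field.
  by rewrite x0 expf_neq0.
Qed.

Lemma is_derive_rpow x a : rpow_dom x a ->
  is_derive x 1 (fun y => rpow y a) (if a == 0 then 0 else a * rpow x (a - 1)).
Proof.
case: eqVneq => [->|a0].
  move=> _; have -> : (fun y : R => rpow y 0) = cst 1; last exact: is_derive_cst.
  by apply/funext => y; rewrite (rpow_nat y 0).
move=> /or3P[/natrP[[|n] an]|/andP[/intrP[m ->] x0]|x0].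
- by rewrite an eqxx in a0.
- rewrite {}an -[X in _ - X]/(1%:R) -natr1 addrK rpow_nat natr1.
  have -> : (fun y : R => rpow y n.+1%:R) = fun y => y ^+ n.+1.
    by apply/funext => y; rewrite rpow_nat.
  exact: is_derive_expn.
- rewrite /rpow -[X in _ - X]/(1%:~R) -intrB !intr_int !intrKfloor; exact: is_derive_expz.
- rewrite /rpow rpredBr ?rpred1//; case: ifPn => [/intrP[m ->]|_].
    by rewrite -[X in _ - X]/(1%:~R) -intrB !intrKfloor; apply: is_derive_expz; rewrite gt_eqF.
  exact: is_derive1_powR.
Qed.

(** A primitive of 1/x on both half-lines serves T_2 with alpha_1 = -1, where r_1 may be
    negative. *)
Lemma is_derive_ln_norm x : x != 0 -> is_derive x 1 (fun y : R => ln `|y|) x^-1.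
Proof.
case: ltgtP => // x0 _.
  apply: (@near_eq_is_derive R R R (@ln R \o -%R) (fun y : R => ln `|y|)).
    near=> y; rewrite /= ltr0_norm//; near: y; exact: lt_nbhsl.
  have h : is_derive (- x) 1 (@ln R) (- x)^-1 by apply: is_derive1_ln; rewrite oppr_gt0.
  have h2 := is_derive1_comp h (is_deriveNid x 1).
  by apply: is_derive_eq h2 _; rewrite invrN mulrN1 opprK.
apply: (@near_eq_is_derive R R R (@ln R) (fun y : R => ln `|y|)); last exact: is_derive1_ln.
by near=> y; rewrite /= gtr0_norm//; near: y; exact: lt_nbhsr.
Unshelve. all: by end_near. Qed.

Lemma is_derive_continuous (f : R -> R) x d :
  is_derive x 1 f d -> {for x, continuous f}.
Proof.
by move=> [df _]; apply/differentiable_continuous/derivable1_diffP.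
Qed.

(** The domain is the whole line, the punctured line or the positive half-line, according as a is a
    natural number, a negative integer or not an integer. *)
Lemma rpow_dom_open a : open [set x : R | rpow_dom x a].
Proof.
have [an|an] := boolP (a \is a Num.nat).
  have -> : [set x : R | rpow_dom x a] = setT; last exact: openT.
  by apply/seteqP; split=> x //= _; rewrite /rpow_dom an.
have [ai|ai] := boolP (a \is a Num.int).
  have -> : [set x : R | rpow_dom x a] = ~` [set 0].
    apply/seteqP; split=> x /=; rewrite /rpow_dom (negbTE an) ai /=.
      by move=> /orP[/eqP//|x0 xe]; rewrite xe ltxx in x0.
    by move=> /eqP ->.
  rewrite openC; exact: closed_eq.
have -> : [set x : R | rpow_dom x a] = [set x | 0 < x]; last exact: open_gt.
by apply/seteqP; split=> x /=; rewrite /rpow_dom (negbTE an) (negbTE ai).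
Qed.

End RealPower.

(** * Formal expressions, their domains and formal derivations *)

Inductive expr (R : realType) :=
| Cst of R
| Var of nat
| Add of expr R & expr R
| Mul of expr R & expr R
| Pow of expr R & R
| Ln of expr R.
Arguments Var {R}.

Section Expressions.
Context {R : realType}.
Implicit Types (e f : expr R) (v w : nat -> expr R) (z y : jet R) (F G : jet R -> R)
  (U : set (jet R)).

Fixpoint eval e z : R :=
  match e with
  | Cst c => c
  | Var k => z k
  | Add f g => eval f z + eval g z
  | Mul f g => eval f z * eval g z
  | Pow f a => rpow (eval f z) a
  | Ln f => ln `|eval f z|
  end.

Fixpoint wd e z : bool :=
  match e with
  | Cst _ | Var _ => true
  | Add f g | Mul f g => wd f z && wd g z
  | Pow f a => wd f z && rpow_dom (eval f z) a
  | Ln f => wd f z && (eval f z != 0)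
  end.

(* [der v] is sum_k v_k d/du_k, so that [der (delta k)] is d/du_k and
   [der jshift] is D_x. *)
Fixpoint der v e : expr R :=
  match e with
  | Cst _ => Cst 0
  | Var k => v k
  | Add f g => Add (der v f) (der v g)
  | Mul f g => Add (Mul (der v f) g) (Mul f (der v g))
  | Pow f a => if a == 0 then Cst 0
               else Mul (Mul (Cst a) (Pow f (a - 1))) (der v f)
  | Ln f => Mul (Pow f (-1)) (der v f)
  end.

Fixpoint vars e : seq nat :=
  match e with
  | Cst _ => [::]
  | Var k => [:: k]
  | Add f g | Mul f g => vars f ++ vars g
  | Pow f _ | Ln f => vars f
  end.

Definition delta (k : nat) : nat -> expr R := fun j => Cst (j == k)%:R.

Definition jshift : nat -> expr R := fun k => Var k.+1.

Lemma eval_eq_vars (P : pred nat) e z y : all P (vars e) ->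
  (forall i, P i -> z i = y i) -> eval e z = eval e y.
Proof.
move=> Pe zy; elim: e Pe => //= [k|f IHf g IHg|f IHf g IHg|f IHf a|f IHf].
- by rewrite andbT => /zy.
- by rewrite all_cat => /andP[/IHf-> /IHg->].
- by rewrite all_cat => /andP[/IHf-> /IHg->].
- by move=> /IHf->.
- by move=> /IHf->.
Qed.

Lemma vars_der (P : pred nat) v e : all P (vars e) ->
  (forall i, i \in vars e -> all P (vars (v i))) -> all P (vars (der v e)).
Proof.
elim: e => //= [k|f IHf g IHg|f IHf g IHg|f IHf a|f IHf].
- by move=> _; apply; rewrite inE.
- rewrite !all_cat => /andP[Pf Pg] h; rewrite IHf ?IHg// => i ie; apply: h;
  by rewrite mem_cat ie ?orbT.
- rewrite !all_cat => /andP[Pf Pg] h; rewrite Pf Pg IHf ?IHg// => i ie; apply: h;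
  by rewrite mem_cat ie ?orbT.
- by case: ifP => //= _ Pf h; rewrite all_cat Pf IHf.
- by move=> Pf h; rewrite all_cat Pf IHf.
Qed.

(** Only nonzero exponents get lowered, and [Ln] yields an inverse where its argument is nonzero, so
    differentiating an expression does not shrink its domain. *)
Lemma wd_der v e z : (forall k, wd (v k) z) -> wd e z -> wd (der v e) z.
Proof.
move=> wv; elim: e => //= [f IHf g IHg|f IHf g IHg|f IHf a|f IHf].
- by move=> /andP[/IHf-> /IHg->].
- by move=> /andP[/[dup] wf /IHf-> /[dup] wg /IHg->]; rewrite wf wg.
- move=> /andP[wf fa]; case: eqVneq => //= a0.
  by rewrite wf IHf// rpow_domB1.
- by move=> /andP[wf f0]; rewrite wf IHf//= /rpow_dom rpredN1 f0 !orbT.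
Qed.

Lemma eval_der_Mul v f g z : eval (der v (Mul f g)) z =
  eval (der v f) z * eval g z + eval f z * eval (der v g) z.
Proof. by []. Qed.

Lemma eval_continuous e z : wd e z -> {for z, continuous (eval e)}.
Proof.
elim: e => /= [c|k|f IHf g IHg|f IHf g IHg|f IHf a|f IHf].
- by move=> _; exact: cst_continuous.
- by move=> _; exact: (@proj_continuous nat (fun _ => R) k z).
- by move=> /andP[/IHf cf /IHg cg]; exact: (cvgD cf cg).
- by move=> /andP[/IHf cf /IHg cg]; exact: (cvgM cf cg).
- move=> /andP[/IHf cf fa].
  exact: (continuous_comp cf (is_derive_continuous (is_derive_rpow fa))).
- move=> /andP[/IHf cf fa].
  exact: (continuous_comp cf (is_derive_continuous (is_derive_ln_norm fa))).
Qed.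

Lemma wd_near e z : wd e z -> \forall y \near z, wd e y.
Proof.
elim: e => /= [c|k|f IHf g IHg|f IHf g IHg|f IHf a|f IHf].
- by move=> _; apply: (@nearW _ (nbhs z)).
- by move=> _; apply: (@nearW _ (nbhs z)).
- by move=> /andP[/IHf wf /IHg wg]; apply: filterS2 wf wg => y -> ->.
- by move=> /andP[/IHf wf /IHg wg]; apply: filterS2 wf wg => y -> ->.
- move=> /andP[wf fa]; have wf' := IHf wf.
  have fa' : \forall y \near z, rpow_dom (eval f y) a.
    have h : nbhs (eval f z) [set x | rpow_dom x a].
      by apply: open_nbhs_nbhs; split=> //; exact: rpow_dom_open.
    exact: (eval_continuous wf h).
  by apply: filterS2 wf' fa' => y -> ->.
- move=> /andP[wf fa]; have wf' := IHf wf.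
  have fa' : \forall y \near z, eval f y != 0.
    have h : nbhs (eval f z) [set x | x != 0].
      by apply: open_nbhs_nbhs; split.
    exact: (eval_continuous wf h).
  by apply: filterS2 wf' fa' => y -> ->.
Qed.

(** * Analytic partial derivatives agree with the formal ones *)

Lemma jet_set_id z k : jet_set z k (z k) = z.
Proof. by apply/funext => j; rewrite /jet_set; case: eqP => [->|]. Qed.

Lemma jet_set_continuous z k : continuous (jet_set z k : R -> jet R).
Proof.
have -> : jet_set z k = @dfwith nat (fun=> R) z k.
  apply/funext => s; apply/funext => j; rewrite /jet_set.
  by case: eqVneq => [->|jk]; rewrite ?dfwithin// dfwithout// eq_sym.
exact: dfwith_continuous.
Qed.

Lemma jet_set_near z k (A : set (jet R)) :
  (\forall y \near z, A y) -> \forall s \near z k, A (jet_set z k s).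
Proof.
move=> zA; have zA' : nbhs (jet_set z k (z k)) A by rewrite jet_set_id.
exact: (jet_set_continuous zA').
Qed.

Lemma is_derive_eval e z k : wd e z ->
  is_derive (z k) 1 (fun s => eval e (jet_set z k s)) (eval (der (delta k) e) z).
Proof.
elim: e => /= [c|j|f IHf g IHg|f IHf g IHg|f IHf a|f IHf].
- by move=> _; exact: is_derive_cst.
- move=> _; rewrite /jet_set; case: eqVneq => _; first exact: is_derive_id.
  exact: is_derive_cst.
- by move=> /andP[/IHf df /IHg dg]; exact: (is_deriveD df dg).
- move=> /andP[/IHf df /IHg dg]; apply: is_derive_eq (is_deriveM df dg) _.
  by rewrite !jet_set_id /GRing.scale/= addrC [_ * eval g z]mulrC.
- move=> /andP[/IHf df fa].
  have h : is_derive (eval f (jet_set z k (z k))) 1 (fun t => rpow t a)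
     (if a == 0 then 0 else a * rpow (eval f z) (a - 1)).
    by rewrite jet_set_id; exact: is_derive_rpow.
  apply: is_derive_eq (is_derive1_comp h df) _.
  by case: ifP => //= _; rewrite mul0r.
- move=> /andP[/IHf df fa].
  have h : is_derive (eval f (jet_set z k (z k))) 1 (fun t : R => ln `|t|)
     (eval f z)^-1.
    by rewrite jet_set_id; exact: is_derive_ln_norm.
  apply: is_derive_eq (is_derive1_comp h df) _.
  by rewrite (rpow_opp_nat _ 1) expr1.
Qed.

Lemma is_derive_near_eval F e z k : (\forall y \near z, F y = eval e y) -> wd e z ->
  is_derive (z k) 1 (fun s => F (jet_set z k s)) (eval (der (delta k) e) z).
Proof.
move=> Fe we.
apply: (@near_eq_is_derive R R R (fun s => eval e (jet_set z k s))
  (fun s => F (jet_set z k s))); last exact: is_derive_eval.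
by apply: (@jet_set_near z k (fun y => eval e y = F y)); apply: filterS Fe => y ->.
Qed.

Lemma pd_near_eval F e z k : (\forall y \near z, F y = eval e y) -> wd e z ->
  pd k F z = eval (der (delta k) e) z.
Proof.
by move=> Fe we; rewrite /pd derive1E; case: (is_derive_near_eval k Fe we).
Qed.

Lemma smooth_on_eval U F e : open U -> (forall z, U z -> wd e z /\ F z = eval e z) ->
  smooth_on U F.
Proof.
move=> oU FU s.
(* A single expression represents the iterated partial derivative on all of U; as U is open, it does
   so near each point, which is what the next partial derivative sees. *)
have [f hf] : exists f, forall z, U z ->
    wd f z /\ foldr (@pd R) F s z = eval f z.
  elim: s => [|k s [f hf]] /=; first by exists e.
  exists (der (delta k) f) => z Uz; split.
    by apply: wd_der => [//|]; have [] := hf z Uz.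
  apply: pd_near_eval; last by have [] := hf z Uz.
  by apply: filterS (open_nbhs_nbhs (conj oU Uz)) => y /hf[].
move=> z Uz; have [wf fz] := hf z Uz.
have near_f : \forall y \near z, foldr (@pd R) F s y = eval f y.
  by apply: filterS (open_nbhs_nbhs (conj oU Uz)) => y /hf[].
split.
  rewrite /prop_for /continuous_at fz.
  move=> A /(eval_continuous wf) fA.
  suff : nbhs z (foldr (@pd R) F s @^-1` A) by [].
  by apply: filterS2 near_f fA => y /= ->.
by move=> k; case: (is_derive_near_eval k near_f wf).
Qed.

(** * Derivations as combinations of partial derivatives; commutators *)

Lemma der_delta_notin e z k : k \notin vars e -> eval (der (delta k) e) z = 0.
Proof.
elim: e => //= [j|f IHf g IHg|f IHf g IHg|f IHf a|f IHf].
- by rewrite inE eq_sym => /negbTE ->.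
- by rewrite mem_cat negb_or => /andP[/IHf-> /IHg->]; rewrite addr0.
- by rewrite mem_cat negb_or => /andP[/IHf-> /IHg->]; rewrite mul0r mulr0 addr0.
- by case: ifP => //= _ /IHf->; rewrite mulr0.
- by move=> /IHf->; rewrite mulr0.
Qed.

(** This links the recursively defined derivations to the sums over k that define [Dx] and [Dt]. *)
Lemma der_sum v e z n : all (fun i => i < n)%N (vars e) ->
  eval (der v e) z = \sum_(k < n) eval (v k) z * eval (der (delta k) e) z.
Proof.
elim: e => //= [c|j|f IHf g IHg|f IHf g IHg|f IHf a|f IHf].
- by move=> _; rewrite big1// => k _; rewrite mulr0.
- rewrite andbT => jn; rewrite (bigD1 (Ordinal jn))//= eqxx mulr1 big1 ?addr0//.
  by move=> k /negbTE kj; rewrite eq_sym [_ == j]kj mulr0.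
- rewrite all_cat => /andP[/IHf-> /IHg->]; rewrite -big_split/=.
  by apply: eq_bigr => k _; rewrite mulrDr.
- rewrite all_cat => /andP[/IHf-> /IHg->]; rewrite mulr_suml mulr_sumr -big_split/=.
  by apply: eq_bigr => k _; ring.
- case: ifP => /= [_ _|_ /IHf->]; first by rewrite big1// => k _; rewrite mulr0.
  by rewrite mulr_sumr; apply: eq_bigr => k _; ring.
- move=> /IHf->.
  by rewrite mulr_sumr; apply: eq_bigr => k _; ring.
Qed.

Lemma vars_bounded e : exists n, all (fun i => i < n)%N (vars e).
Proof.
exists (\max_(i <- vars e) i).+1; apply/allP => i ie.
by rewrite ltnS; exact: leq_bigmax_seq.
Qed.

Lemma Dx_near_eval F e z : (\forall y \near z, F y = eval e y) -> wd e z ->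
  Dx F z = eval (der jshift e) z.
Proof.
move=> Fe we; have [n en] := vars_bounded e.
rewrite (der_sum _ _ en) (fsbig_ord _ n (fun k => z k.+1 * eval (der (delta k) e) z)).
have -> : Dx F z = \sum_(k \in [set: nat]) z k.+1 * eval (der (delta k) e) z.
  by apply: eq_fsbigr => k _; rewrite (pd_near_eval k Fe we).
(* Variables that do not occur contribute zero, so the sum over all k stops at n. *)
apply/esym/fsbig_widen => // k [_ /= nk]; rewrite der_delta_notin ?mulr0//.
by apply/negP => /(allP en).
Qed.

(** The commutator of two derivations is a derivation, so its values [c] on the variables determine
    it. The predicate [P] confines the hypothesis to variables on which the commutator is known. *)
Lemma der_comm v w c (P : pred nat) e z :
  (forall k, P k -> eval (der v (w k)) z = eval (der w (v k)) z + eval (c k) z) ->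
  all P (vars e) ->
  eval (der v (der w e)) z = eval (der w (der v e)) z + eval (der c e) z.
Proof.
move=> vw; elim: e => //= [b|k|f IHf g IHg|f IHf g IHg|f IHf a|f IHf].
- by rewrite addr0.
- by rewrite andbT => /vw.
- by rewrite all_cat => /andP[/IHf-> /IHg->]; ring.
- by rewrite all_cat => /andP[/IHf-> /IHg->]; ring.
- move=> /IHf fE; case: ifP => //= _; first by rewrite addr0.
  by case: ifP => //= _; rewrite fE; ring.
- by move=> /IHf fE; case: ifP => //= _; rewrite fE; ring.
Qed.

(** A formal derivative is a combination of analytic partial derivatives, so it depends only on the
    germ of the function. Hence identities that hold near a point can be differentiated. *)
Lemma der_near_eq v e f z : (\forall y \near z, eval e y = eval f y) ->
  wd e z -> wd f z -> eval (der v e) z = eval (der v f) z.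
Proof.
move=> ef we wf; have [n en] := vars_bounded (Add e f).
move: (en); rewrite /= all_cat => /andP[en1 fn1].
rewrite (der_sum _ _ en1) (der_sum _ _ fn1); apply: eq_bigr => k _; congr (_ * _).
have [_ <-] := is_derive_near_eval k ef wf.
by have [_ <-] := is_derive_eval k we.
Qed.

End Expressions.

(** * Expressions for r_k and T_k, and their domains *)

Section HunterSaxton.
Context {R : realType}.
Implicit Types (e f : expr R) (z y : jet R) (alpha : nat -> R).

Fixpoint r_expr (k : nat) : expr R :=
  match k with
  | 0 => Mul (Cst (-1)) (Pow (Var 1) (-1))
  | k'.+1 => Mul (Pow (Var 1) (- 2)) (der jshift (r_expr k'))
  end.

(* P_expr k alpha is T_k / u_1^2. *)
Fixpoint P_expr (k : nat) alpha : expr R :=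
  match k with
  | 0 => Cst 1
  | k'.+1 => Mul (P_expr k' alpha) (Pow (r_expr k'.+1) (alpha k'.+1))
  end.

Lemma P_exprS k alpha :
  P_expr k.+1 alpha = Mul (P_expr k alpha) (Pow (r_expr k.+1) (alpha k.+1)).
Proof. by []. Qed.

Lemma eval_P_exprS k alpha z : eval (P_expr k.+1 alpha) z =
  eval (P_expr k alpha) z * rpow (eval (r_expr k.+1) z) (alpha k.+1).
Proof. by []. Qed.

Definition T_expr (k : nat) alpha : expr R :=
  Mul (Mul (Var 1) (Var 1)) (P_expr k alpha).

Lemma near_jetW z (P Q : jet R -> Prop) : (forall y, P y -> Q y) ->
  (\forall y \near z, P y) -> \forall y \near z, Q y.
Proof. exact: (@filterS _ (nbhs z)). Qed.

(** The condition u_1 != 0 is the well-definedness of [Ln (Var 1)], which is an open condition. *)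
Lemma u1_near z : z 1%N != 0 -> \forall y \near z, y 1%N != 0.
Proof. by move=> z1; apply: (@wd_near R (Ln (Var 1)) z). Qed.

Lemma wd_r_expr k z : z 1%N != 0 -> wd (r_expr k) z.
Proof.
move=> z1; elim: k => [|k IH] /=.
  by rewrite /rpow_dom rpredN1 z1 orbT.
by rewrite wd_der// andbT /rpow_dom rpredN natr_int z1 orbT.
Qed.

Lemma r_eval k z : z 1%N != 0 -> r k z = eval (r_expr k) z.
Proof.
elim: k z => [|k IH] z z1 /=.
  by rewrite (rpow_opp_nat _ 1) expr1 mulN1r.
have near_z : \forall y \near z, r k y = eval (r_expr k) y.
  by apply: near_jetW (u1_near z1) => y; exact: IH.
by rewrite rpow_opp_nat (Dx_near_eval near_z)// wd_r_expr.
Qed.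

Lemma jshift_r_expr k z : z 1%N != 0 ->
  eval (der jshift (r_expr k)) z = z 1%N ^+ 2 * eval (r_expr k.+1) z.
Proof. by move=> z1 /=; rewrite rpow_opp_nat mulVKf// expf_neq0. Qed.

Lemma vars_jshift (n : nat) e : all (fun i => 0 < i <= n)%N (vars e) ->
  all (fun i => 0 < i <= n.+1)%N (vars (der jshift e)).
Proof.
move=> en; apply: vars_der.
  by apply: sub_all en => i /andP[->] /= /leqW.
by move=> i /(allP en) /andP[_ h] /=; rewrite andbT ltnS.
Qed.

Lemma vars_r_expr k : all (fun i => 0 < i <= k.+1)%N (vars (r_expr k)).
Proof. by elim: k => //= k IH; exact: vars_jshift. Qed.

Lemma vars_P_expr k alpha : all (fun i => 0 < i <= k.+1)%N (vars (P_expr k alpha)).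
Proof.
elim: k => // k IH; rewrite [vars _]/(vars (P_expr k alpha) ++ vars (r_expr k.+1)).
rewrite all_cat vars_r_expr andbT.
by apply: sub_all IH => i /andP[->] /= /leqW.
Qed.

Lemma vars_T_expr k alpha : all (fun i => 0 < i <= k.+1)%N (vars (T_expr k alpha)).
Proof. exact: vars_P_expr. Qed.

Lemma T_dom_u1 k alpha z : (0 < k)%N -> T_dom k alpha z -> z 1%N != 0.
Proof. by move=> k0 /(_ 1%N); rewrite k0 => /(_ isT)[]. Qed.

Lemma T_domS k alpha z : T_dom k.+1 alpha z -> T_dom k alpha z.
Proof. by move=> h i /andP[i0 ik]; apply: h; rewrite i0 leqW. Qed.

Lemma wd_P_exprS k alpha z : wd (P_expr k.+1 alpha) z =
  [&& wd (P_expr k alpha) z, wd (r_expr k.+1) z &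
      rpow_dom (eval (r_expr k.+1) z) (alpha k.+1)].
Proof. by []. Qed.

Lemma T_domP k alpha z : T_dom k alpha z <->
  ((0 < k)%N -> z 1%N != 0) /\ wd (P_expr k alpha) z.
Proof.
split=> [h|[]].
  split; first by move=> k0; exact: T_dom_u1 h.
  elim: k h => // k IH h; have [z1 hk] := h k.+1 (leqnn _).
  by rewrite wd_P_exprS (IH (T_domS h)) (wd_r_expr _ z1) -(r_eval _ z1).
elim: k => [_ _ i /andP[i0 /(leq_trans i0)//]|k IH /(_ isT) z1].
rewrite wd_P_exprS => /andP[wP /andP[_ hk]] i /andP[i0].
rewrite leq_eqVlt => /predU1P[->|ik]; first by rewrite r_eval.
by apply: (IH (fun=> z1) wP); rewrite i0 -ltnS.
Qed.

Lemma open_T_dom k alpha : open (T_dom k alpha).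
Proof.
case: k => [|k].
  rewrite (_ : T_dom 0 alpha = setT); first exact: openT.
  by apply/seteqP; split=> // z _ i /andP[i0 /(leq_trans i0)].
rewrite openE => z /T_domP[/(_ isT) z1 wP].
(* Both conditions of [T_domP] are packed into the well-definedness of one expression. *)
have w : wd (Mul (Ln (Var 1)) (P_expr k.+1 alpha)) z by apply/andP.
suff : \forall y \near z, T_dom k.+1 alpha y by [].
by apply: near_jetW (wd_near w) => y /andP[y1 wPy]; apply/T_domP.
Qed.

Lemma T_eval k alpha z : ((0 < k)%N -> z 1%N != 0) ->
  T k alpha z = eval (T_expr k alpha) z.
Proof.
elim: k => [_|k IH /(_ isT) z1]; first by rewrite /= mulr1.
rewrite [LHS]/(T k alpha z * rpow (r k.+1 z) (alpha k.+1)) IH//.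
by rewrite (r_eval _ z1); exact/esym/mulrA.
Qed.

Lemma wd_T_expr k alpha z : T_dom k alpha z -> wd (T_expr k alpha) z.
Proof. by move=> /T_domP[]. Qed.

Lemma diff_fun_eval (U : set (jet R)) F e : open U ->
  (forall z, U z -> wd e z /\ F z = eval e z) -> diff_fun U F.
Proof.
move=> oU UF; split=> //; last exact: smooth_on_eval UF.
have [n en] := vars_bounded e; exists n => z y Uz Uy zy.
rewrite (UF z Uz).2 (UF y Uy).2; apply: (eval_eq_vars en) => i /ltnW.
exact: zy.
Qed.

Lemma in_im_Dx_eval (U : set (jet R)) G e : open U ->
  (forall z, U z -> wd e z /\ G z = eval (der jshift e) z) -> in_im_Dx U G.
Proof.
move=> oU UG; exists (eval e); first by apply: (@diff_fun_eval _ _ e oU) => z /UG[].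
move=> z /UG[we ->]; rewrite (@Dx_near_eval _ _ e)//.
exact: (@nearW _ (nbhs z)).
Qed.

(** * The Hunter-Saxton flow and conservation of T_k *)

Definition HS_expr : expr R :=
  Add (Mul (Mul (Cst 2) (Var 0)) (Var 2)) (Mul (Var 1) (Var 1)).

(* The derivation [der flow] is D_t on functions not depending on u_0; the value
   at 0 is arbitrary. *)
Definition flow (k : nat) : expr R :=
  if k is k'.+1 then iter k' (der jshift) HS_expr else Cst 0.

Lemma wd_flow k z : wd (flow k) z.
Proof. by case: k => //; elim=> //= k IH; exact: wd_der. Qed.

Lemma eval_flow k z : iter k (@Dx R) (@HS_rhs R) z = eval (flow k.+1) z.
Proof.
elim: k z => [|k IH] z; first by rewrite /= /HS_rhs expr2.
rewrite [LHS]/= (@Dx_near_eval _ _ (flow k.+1)) ?wd_flow//.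
exact: (@nearW _ (nbhs z)).
Qed.

Lemma Dt_near_eval F e z : (\forall y \near z, F y = eval e y) -> wd e z ->
  Dt F z = eval (der flow e) z.
Proof.
move=> Fe we; have [n en] := vars_bounded e.
rewrite (der_sum _ _ en) (fsbig_ord _ n (fun k => eval (flow k) z * eval (der (delta k) e) z)).
have -> : Dt F z = \sum_(k \in [set k | (1 <= k)%N])
    eval (flow k) z * eval (der (delta k) e) z.
  by apply: eq_fsbigr => -[|k]; rewrite inE// => _; rewrite (pd_near_eval _ Fe we) eval_flow.
(* The index k = 0 can be added because [flow 0] is zero. *)
rewrite [LHS](fsbig_widen _ setT)//; last first.
  by move=> [_|k [_ []//]]; exact: mul0r.
apply/esym/fsbig_widen => // k [_ /= nk]; rewrite der_delta_notin ?mulr0//.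
by apply/negP => /(allP en).
Qed.

(** For k >= 1, [flow k.+1] is by construction D_x of [flow k], so the commutator vanishes on u_k.
    It does not vanish on u_0, where [flow] is set to 0. *)
Lemma flow_jshift_comm e z : all (fun i => 0 < i)%N (vars e) ->
  eval (der flow (der jshift e)) z = eval (der jshift (der flow e)) z.
Proof.
move=> e0; rewrite (@der_comm _ flow jshift (fun=> Cst 0) _ _ _ _ e0); last first.
  by case=> //= k _; rewrite addr0.
have [n en] := vars_bounded e.
by rewrite (der_sum _ _ en) big1 ?addr0// => k _; rewrite mul0r.
Qed.

(** This says L r_k = delta_(k,0). In the inductive step, D_x of the factor 2 u gives 2 u_1 D_x r_k,
    which L applied to u_1^-2 cancels; the constant disappears under D_x. *)
Lemma flow_r_expr k z : z 1%N != 0 ->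
  eval (der flow (r_expr k)) z =
  2 * z 0%N * eval (der jshift (r_expr k)) z + (k == 0)%:R.
Proof.
elim: k z => [|k IH] z z1.
  rewrite /= oppr_eq0 oner_eq0 /=.
  have -> : -1 - 1 = - 2%:R :> R by ring.
  by rewrite rpow_opp_nat; field.
have near_z : \forall y \near z, eval (der flow (r_expr k)) y =
    eval (Add (Mul (Mul (Cst 2) (Var 0)) (der jshift (r_expr k))) (Cst (k == 0)%:R)) y.
  by apply: near_jetW (u1_near z1) => y /IH.
have comm : eval (der flow (der jshift (r_expr k))) z =
    eval (der jshift (der flow (r_expr k))) z.
  apply: flow_jshift_comm; apply: sub_all (vars_r_expr k) => i; by case/andP.
rewrite [r_expr _]/= /= oppr_eq0 pnatr_eq0 /= comm (der_near_eq _ near_z)/=.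
- have -> : -2 - 1 = - 3%:R :> R by ring.
  by rewrite !rpow_opp_nat; field.
- by rewrite wd_der ?wd_r_expr// => j; exact: wd_flow.
- by rewrite wd_der ?wd_r_expr.
Qed.

(** L is a derivation and kills every r_i with i >= 1, hence also products of their powers. *)
Lemma flow_P_expr k alpha z : ((0 < k)%N -> z 1%N != 0) ->
  eval (der flow (P_expr k alpha)) z = 2 * z 0%N * eval (der jshift (P_expr k alpha)) z.
Proof.
elim: k => [|k IH] z1; first by rewrite /= mulr0.
rewrite P_exprS.
move: (r_expr k.+1) (@flow_r_expr k.+1 z (z1 isT)) => f fE.
rewrite /= IH => [|_]; last exact: z1.
case: ifP => _ /=; first by ring.
by rewrite fE /=; ring.
Qed.

(** L (u_1^2) = 2 u_1 u_1^2 is D_x (2 u) times u_1^2, the term that completes 2 u D_x T_k to D_x (2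
    u T_k). *)
Lemma flow_T_expr k alpha z : ((0 < k)%N -> z 1%N != 0) ->
  eval (der flow (T_expr k alpha)) z =
  eval (der jshift (Mul (Mul (Cst 2) (Var 0)) (T_expr k alpha))) z.
Proof. by move=> z1 /=; rewrite flow_P_expr//; ring. Qed.

Lemma T_conserved k alpha : conserved_density (T_dom k alpha) (T k alpha).
Proof.
have oU := open_T_dom k alpha.
have UT z : T_dom k alpha z ->
    wd (T_expr k alpha) z /\ T k alpha z = eval (T_expr k alpha) z.
  by move=> /[dup] /T_domP[z1 _] /wd_T_expr wT; rewrite T_eval.
split; first exact: diff_fun_eval UT.
- move=> z y Uz Uy zy; rewrite (UT z Uz).2 (UT y Uy).2.
  by apply: (eval_eq_vars (vars_T_expr k alpha)) => i /andP[/zy].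
- apply: (@in_im_Dx_eval _ _ (Mul (Mul (Cst 2) (Var 0)) (T_expr k alpha))) => // z Uz.
  split; first exact: wd_T_expr.
  rewrite -flow_T_expr; last by move=> k0; exact: T_dom_u1 Uz.
  apply: Dt_near_eval; last exact: wd_T_expr.
  by apply: filterS (open_nbhs_nbhs (conj oU Uz)) => y /UT[].
Qed.

(** * The exact order of T_k *)

Lemma T_order_le k alpha : order_le (T_dom k alpha) k.+1 (T k alpha).
Proof.
move=> z y /T_domP[z1 _] /T_domP[y1 _] zy; rewrite !T_eval//.
by apply: (eval_eq_vars (vars_T_expr k alpha)) => i /andP[_ /zy].
Qed.

(** The commutator of d/du_(k+2) with D_x is d/du_(k+1), and r_k is free of u_(k+2); so each step
    multiplies the leading coefficient by u_1^-2. *)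
Lemma der_delta_r_expr k z : z 1%N != 0 -> eval (der (delta k.+1) (r_expr k)) z != 0.
Proof.
move=> z1; elim: k => [|k IH].
  rewrite /= oppr_eq0 oner_eq0 /=.
  have -> : -1 - 1 = - 2%:R :> R by ring.
  by rewrite rpow_opp_nat mul0r add0r mulr1 !mulN1r opprK invr_neq0// expf_neq0.
have dd y : eval (der (delta k.+2) (r_expr k)) y = eval (Cst 0) y.
  by apply: der_delta_notin; apply/negP => /(allP (vars_r_expr k)); rewrite ltnn andbF.
have near_z : \forall y \near z, eval (der (delta k.+2) (r_expr k)) y = eval (Cst 0) y.
  exact: (@nearW _ (nbhs z)).
have comm : eval (der (delta k.+2) (der jshift (r_expr k))) z =
    eval (der (delta k.+1) (r_expr k)) z.
  rewrite (@der_comm _ _ _ (delta k.+1) predT) ?all_predT//; last first.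
    by move=> j _; rewrite /= add0r.
  by rewrite (der_near_eq _ near_z) ?wd_der ?wd_r_expr//= add0r.
rewrite [r_expr _]/= /= oppr_eq0 pnatr_eq0 /= comm mulr0 mul0r add0r.
by rewrite mulf_neq0// rpow_opp_nat invr_neq0// expf_neq0.
Qed.

(** At such a jet every real power of r_1, ..., r_k is defined and equals 1, so it lies in every
    [T_dom k alpha]. The coordinates are chosen one after another. *)
Lemma eval_r_expr1 k :
  exists z, z 1%N = 1 /\ forall i, (0 < i <= k)%N -> eval (r_expr i) z = 1.
Proof.
elim: k => [|k [z [z1 zr]]].
  by exists (fun=> 1); split=> // i /andP[i0 /(leq_trans i0)].
have u0 : z 1%N != 0 by rewrite z1 oner_eq0.
have c0 := der_delta_r_expr k u0.
set c := eval _ z in c0.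
pose d := \sum_(j < k.+1) z j.+1 * eval (der (delta j) (r_expr k)) z.
(* With u_1 = 1, r_(k+1) = d + c u_(k+2), where c and d involve only lower coordinates; this value
   of u_(k+2) makes it 1. *)
have [y [yk ylt]] : exists y, y k.+2 = (1 - d) / c /\
    forall j, (j < k.+2)%N -> y j = z j.
  exists (jet_set z k.+2 ((1 - d) / c)); rewrite /jet_set eqxx.
  by split=> // j jk; rewrite ltn_eqF.
have lt_eval e : all (fun i => 0 < i <= k.+1)%N (vars e) -> eval e y = eval e z.
  by move=> ek; apply: (eval_eq_vars ek) => i /andP[_ ik]; exact: ylt.
have vd j : all (fun i => 0 < i <= k.+1)%N (vars (der (delta j) (r_expr k))).
  exact: vars_der (vars_r_expr k) _.
have vk : all (fun i => i < k.+2)%N (vars (r_expr k)).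
  by apply: sub_all (vars_r_expr k) => j /andP[].
exists y; rewrite ylt//; split=> [//|i /andP[i0]].
rewrite leq_eqVlt => /predU1P[->|ik]; last first.
  rewrite lt_eval ?zr ?i0//; apply: sub_all (vars_r_expr i) => j /andP[->] /=.
  by move=> ji; apply: leq_trans ji _.
rewrite /= rpow_opp_nat ylt// z1 expr1n invr1 mul1r.
rewrite (der_sum _ _ vk) big_ord_recr/= lt_eval// -/c yk.
rewrite (eq_bigr (fun j : 'I_k.+1 => z j.+1 * eval (der (delta j) (r_expr k)) z)).
  by rewrite -/d divfK// addrC subrK.
by move=> j _; rewrite lt_eval//= ylt// ltnS ltn_ord.
Qed.

Lemma eval_P_expr1 k alpha z : (forall i, (0 < i <= k)%N -> eval (r_expr i) z = 1) ->
  eval (P_expr k alpha) z = 1.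
Proof.
elim: k => // k IH h; rewrite eval_P_exprS h ?leqnn// rpow1 mulr1; apply: IH => i /andP[i0 ik].
by apply: h; rewrite i0 leqW.
Qed.

(** Where u_1 and all the r_i are 1, the derivative of T_k in u_(k+1) is alpha_k times that of r_k;
    for k = 0 it is 2. *)
Lemma T_has_order k alpha : k = 0%N \/ alpha k <> 0 ->
  has_order (T_dom k alpha) k.+1 (T k alpha).
Proof.
move=> ka; split; first exact: T_order_le.
have [z [z1 zr]] := eval_r_expr1 k.
have u0 : z 1%N != 0 by rewrite z1 oner_eq0.
have Uz : T_dom k alpha z.
  by move=> i ik; split=> //; rewrite r_eval// zr// /rpow_dom ltr01 !orbT.
exists z => //; rewrite (@pd_near_eval _ _ (T_expr k alpha)); last exact: wd_T_expr.
  case: k => [|k] in ka zr Uz *; first by rewrite /= z1; apply/eqP; lra.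
  case: ka => // /eqP ak.
  have dP : eval (der (delta k.+2) (P_expr k alpha)) z = 0.
    by apply: der_delta_notin; apply/negP => /(allP (vars_P_expr k alpha)); rewrite ltnn andbF.
  have P1 : eval (P_expr k alpha) z = 1.
    by apply: eval_P_expr1 => i /andP[i0 ik]; apply: zr; rewrite i0 leqW.
  have dr := der_delta_r_expr k.+1 u0.
  have r1 := zr k.+1 (leqnn _).
  rewrite /T_expr P_exprS; move: (r_expr k.+1) dr r1 => f dr r1.
  rewrite /= (negbTE ak) /= dP P1 r1 !rpow1 z1 mul0r !mulr0 !add0r !mul0r add0r !mul1r mulr1.
  by apply/eqP; rewrite mulf_neq0.
have oU := open_T_dom k alpha.
apply: near_jetW (open_nbhs_nbhs (conj oU Uz)) => y /T_domP[y1 _].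
exact: T_eval.
Qed.

(** * Equivalences by integration by parts *)

Definition raise alpha (i : nat) : nat -> R :=
  fun j => alpha j - (j == i)%:R + (j == i.+1)%:R.

Lemma eq_P_expr k alpha (beta : nat -> R) :
  (forall j, (0 < j <= k)%N -> alpha j = beta j) -> P_expr k alpha = P_expr k beta.
Proof.
elim: k => // k IH h; rewrite !P_exprS IH ?h ?leqnn// => j /andP[j0 jk].
by apply: h; rewrite j0 leqW.
Qed.

(** For a = 0 the factor a annihilates the power with exponent -1, so the formula holds even where
    that power is undefined. *)
Lemma jshift_pow_r_expr k a z : z 1%N != 0 ->
  eval (der jshift (Pow (r_expr k) a)) z =
  a * rpow (eval (r_expr k) z) (a - 1) * (z 1%N ^+ 2 * eval (r_expr k.+1) z).
Proof.
move=> z1; rewrite -jshift_r_expr// [der _ _]/=.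
by case: eqVneq => [->|_]; rewrite ?mul0r.
Qed.

(** This is the product rule: D_x r_i = u_1^2 r_(i+1) trades one factor r_i for one r_(i+1), as in
    [raise]. For i = n the new factor lies outside P_n, so a power of r_(n+1) with free exponent b
    is carried along to absorb it. *)
Lemma jshift_P_expr n alpha b z : z 1%N != 0 ->
  (forall i, (0 < i <= n)%N -> rpow_dom (eval (r_expr i) z) (alpha i)) ->
  rpow_dom (eval (r_expr n.+1) z) b ->
  eval (der jshift (P_expr n alpha)) z * rpow (eval (r_expr n.+1) z) b =
  \sum_(1 <= i < n.+1) alpha i * (z 1%N ^+ 2 * eval (P_expr n (raise alpha i)) z *
                                  rpow (eval (r_expr n.+1) z) (b + (i == n)%:R)).
Proof.
move=> z1; elim: n b => [|n IH] b dom_alpha dom_b.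
  by rewrite big_geq// mul0r.
have dom_n : forall i, (0 < i <= n)%N -> rpow_dom (eval (r_expr i) z) (alpha i).
  by move=> i /andP[i0 ik]; apply: dom_alpha; rewrite i0 leqW.
rewrite [RHS]big_nat_recr// eqxx rpowS// eval_P_exprS.
have -> : P_expr n (raise alpha n.+1) = P_expr n alpha.
  apply: eq_P_expr => j /andP[_ jn].
  by rewrite /raise !ltn_eqF ?subr0 ?addr0// ltnS ?leqW.
have -> : raise alpha n.+1 n.+1 = alpha n.+1 - 1.
  by rewrite /raise eqxx ltn_eqF// addr0.
rewrite (eq_big_nat _ _ (F2 := fun i =>
  alpha i * (z 1%N ^+ 2 * eval (P_expr n (raise alpha i)) z *
     rpow (eval (r_expr n.+1) z) (alpha n.+1 + (i == n)%:R)) *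
  rpow (eval (r_expr n.+2) z) b)); last first.
  move=> i /andP[i0 ik]; rewrite eval_P_exprS (ltn_eqF ik) addr0.
  rewrite {2}/raise (gtn_eqF ik) subr0 eqSS [n == i]eq_sym; ring.
(* The terms with i <= n are the induction hypothesis for b = alpha_(n+1), times r_(n+2)^b. *)
rewrite -mulr_suml -IH//; last by apply: dom_alpha; rewrite leqnn.
rewrite P_exprS eval_der_Mul jshift_pow_r_expr//.
by rewrite /=; ring.
Qed.

(** T_1 = u_1^2 r_1 = D_x r_0. *)
Lemma T1_func_eq0 alpha : let beta := set_exp alpha 1 1 in
  func_eq (T_dom 1 beta) (T 1 beta) (fun=> 0).
Proof.
move=> beta; apply: (@in_im_Dx_eval _ _ (r_expr 0)); first exact: open_T_dom.
move=> z Uz; have z1 := T_dom_u1 (ltn0Sn 0) Uz; split; first exact: wd_r_expr.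
rewrite subr0 T_eval// jshift_r_expr//.
rewrite /T_expr P_exprS; move: (r_expr 1) => f /=.
by rewrite /beta /set_exp /= (rpow_nat _ 1) expr1; ring.
Qed.

Lemma T2_func_eq0 alpha : let beta := set_exp alpha 2 1 in
  func_eq (T_dom 2 beta) (T 2 beta) (fun=> 0).
Proof.
move=> beta.
have T2 z : z 1%N != 0 -> T 2 beta z =
    rpow (eval (r_expr 1) z) (alpha 1%N) * eval (der jshift (r_expr 1)) z.
  move=> z1; rewrite T_eval// jshift_r_expr// /T_expr !P_exprS.
  move: (r_expr 1) (r_expr 2) => f g /=.
  by rewrite /beta /set_exp /= (rpow_nat _ 1) expr1; ring.
have dom1 z : T_dom 2 beta z -> rpow_dom (eval (r_expr 1) z) (alpha 1%N).
  by move=> /(_ 1%N isT)[z1]; rewrite r_eval.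
(* The primitive of r_1^alpha_1 D_x r_1 is ln |r_1| for alpha_1 = -1, and r_1^(alpha_1 + 1) /
   (alpha_1 + 1) otherwise. *)
have [a1|a1] := eqVneq (alpha 1%N + 1) 0.
  have {}a1 : alpha 1%N = - 1%:R by apply/eqP; rewrite -addr_eq0 a1.
  apply: (@in_im_Dx_eval _ _ (Ln (r_expr 1))); first exact: open_T_dom.
  move=> z Uz; have z1 := T_dom_u1 (ltn0Sn 1) Uz.
  have := dom1 z Uz; rewrite a1 => r1.
  split; last by rewrite subr0 T2// a1.
  rewrite [wd _ _]/(wd (r_expr 1) z && _) wd_r_expr//=.
  case/or3P: r1 => [|/andP[]//|/lt0r_neq0//].
  by rewrite natrEint oppr_ge0 ler10 andbF.
apply: (@in_im_Dx_eval _ _ (Mul (Cst (alpha 1%N + 1)^-1) (Pow (r_expr 1) (alpha 1%N + 1)))).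
  exact: open_T_dom.
move=> z Uz; have z1 := T_dom_u1 (ltn0Sn 1) Uz.
have r1 := dom1 z Uz.
split.
  rewrite [wd _ _]/(wd (r_expr 1) z && rpow_dom (eval (r_expr 1) z) _) wd_r_expr//=.
  exact: rpow_domS.
rewrite subr0 T2// eval_der_Mul jshift_pow_r_expr// -jshift_r_expr// addrK.
by rewrite [eval (der _ (Cst _)) z]/= [eval (Cst _) z]/=; field.
Qed.

(** With k = n + 1 and a = alpha_k + 1, T_(k+1) = P_n r_k^(a-1) D_x r_k. Integrating the last two
    factors to r_k^a / a leaves -D_x(P_n) r_k^a / a, which is the sum. *)
Lemma T_shift_func_eq n alpha : alpha n.+1 <> -1 ->
  let beta := set_exp alpha n.+2 1 in
  func_eq (T_dom n.+2 beta) (T n.+2 beta)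
    (fun z => - \sum_(1 <= i < n.+1)
        alpha i / (alpha n.+1 + 1) * T n.+1 (shift_exp alpha n.+1 i) z).
Proof.
move=> /eqP; rewrite -addr_eq0 => a1 beta; set a := alpha n.+1 + 1 in a1 *.
have betaE j : (j <= n.+1)%N -> beta j = alpha j.
  by move=> jn; rewrite /beta /set_exp ltn_eqF.
apply: (@in_im_Dx_eval _ _
  (Mul (Cst a^-1) (Mul (P_expr n alpha) (Pow (r_expr n.+1) a)))).
  exact: open_T_dom.
move=> z Uz; have z1 := T_dom_u1 (ltn0Sn n.+1) Uz.
have dom_alpha i : (0 < i <= n.+1)%N -> rpow_dom (eval (r_expr i) z) (alpha i).
  move=> /andP[i0 ik]; have [|_] := Uz i; first by rewrite i0 leqW.
  by rewrite r_eval// betaE.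
have dom_n i : (0 < i <= n)%N -> rpow_dom (eval (r_expr i) z) (alpha i).
  by move=> /andP[i0 ik]; apply: dom_alpha; rewrite i0 leqW.
have dom_a : rpow_dom (eval (r_expr n.+1) z) a.
  by apply: rpow_domS; apply: dom_alpha; rewrite leqnn.
have wP : wd (P_expr n alpha) z.
  suff /T_domP[] : T_dom n alpha z by [].
  by move=> i /dom_n; rewrite r_eval.
split.
  rewrite [wd _ _]/(wd (P_expr n alpha) z && (wd (r_expr n.+1) z && _)).
  by rewrite wP wd_r_expr.
(* [shift_exp] agrees with [raise] below k = n + 1; at k its exponent is a, or a + 1 when i = n, as
   in the product rule with b = a. *)
have sumE : \sum_(1 <= i < n.+1) alpha i / a * T n.+1 (shift_exp alpha n.+1 i) z =
    a^-1 * (eval (der jshift (P_expr n alpha)) z * rpow (eval (r_expr n.+1) z) a).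
  rewrite jshift_P_expr// mulr_sumr; apply: eq_big_nat => i /andP[i0 ik].
  rewrite T_eval// /T_expr P_exprS.
  have -> : P_expr n (shift_exp alpha n.+1 i) = P_expr n (raise alpha i).
    apply: eq_P_expr => j /andP[_ jn].
    by rewrite /shift_exp /raise (ltn_eqF (_ : j < n.+1)%N)// addr0.
  have -> : shift_exp alpha n.+1 i n.+1 = a + (i == n)%:R.
    rewrite /shift_exp /a eqxx (gtn_eqF ik) eqSS [n == i]eq_sym /=; ring.
  by move: (r_expr n.+1) => f /=; ring.
rewrite sumE T_eval// [T_expr _ _]/T_expr P_exprS.
have -> : P_expr n.+1 beta = P_expr n.+1 alpha.
  by apply: eq_P_expr => j /andP[_]; exact: betaE.
rewrite P_exprS !eval_der_Mul jshift_pow_r_expr// {2}/a addrK.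
have -> : beta n.+2 = 1%:R by rewrite /beta /set_exp eqxx.
move: (r_expr n.+1) (r_expr n.+2) => f g /=.
by rewrite rpow_nat expr1; field.
Qed.

End HunterSaxton.

Theorem theorem2 (R : realType) :
  (forall (k : nat) (alpha : nat -> R),
     [/\ conserved_density (T_dom k alpha) (T k alpha),
         order_le (T_dom k alpha) k.+1 (T k alpha)
       & (k = 0%N \/ alpha k <> 0) ->
           has_order (T_dom k alpha) k.+1 (T k alpha)]) /\
  (forall alpha : nat -> R,
     let beta := set_exp alpha 1 1 in
     func_eq (T_dom 1 beta) (T 1 beta) (fun=> 0)) /\
  (forall alpha : nat -> R,
     let beta := set_exp alpha 2 1 in
     func_eq (T_dom 2 beta) (T 2 beta) (fun=> 0)) /\
  (forall (k : nat) (alpha : nat -> R), (2 <= k)%N -> alpha k <> -1 ->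
     let beta := set_exp alpha k.+1 1 in
     func_eq (T_dom k.+1 beta) (T k.+1 beta)
       (fun z => - \sum_(1 <= i < k)
                     alpha i / (alpha k + 1) * T k (shift_exp alpha k i) z)).
Proof.
split=> [k alpha|].
  by split; [exact: T_conserved | exact: T_order_le | exact: T_has_order].
split; first exact: T1_func_eq0.
split; first exact: T2_func_eq0.
by case=> // n alpha _; exact: T_shift_func_eq.
Qed.
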